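(* Let $\mathcal{K},\mathcal{H}$ be complex Hilbert spaces and let $\phi$ be non-zero and extremal in the cone of all positive maps from $\mathfrak{B}(\mathcal{K})$ into $\mathfrak{B}(\mathcal{H})$. If $\phi$ is $2$-positive (resp. $2$-copositive), then $\phi$ is completely positive (resp. completely copositive).
   Context: $\mathfrak{B}(\mathcal{K})$ denotes the bounded operators on $\mathcal{K}$. A (bounded) linear map $\phi:\mathfrak{B}(\mathcal{K})\to\mathfrak{B}(\mathcal{H})$ is positive if it maps positive operators to positive operators; for maps, $\psi\leq\phi$ means that $\phi-\psi$ is positive. A face of a cone $K$ is a subset $F\subseteq K$ that is itself a cone and such that $0\leq v\leq w$, $w\in F$, $v\in K$ imply $v\in F$; an element $v$ of a cone is extremal if $\{\lambda v:\lambda\geq0\}$ is a face. For $k\in\mathbb{N}$ define $\phi_k,\phi^k:M_k(\mathfrak{B}(\mathcal{K}))\to M_k(\mathfrak{B}(\mathcal{H}))$ by $\phi_k([A_{ij}])=[\phi(A_{ij})]$ and $\phi^k([A_{ij}])=[\phi(A_{ji})]$. $\phi$ is $k$-positive (resp. $k$-copositive) if $\phi_k$ (resp. $\phi^k$) is positive, and completely positive (resp. completely copositive) if this holds for every $k$. *)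

(* Defs.v *)
From HB Require Import structures.
From mathcomp Require Import all_boot all_order all_algebra complex.
From mathcomp Require Import boolp classical_sets reals topology normedtype.

Set Implicit Arguments.
Unset Strict Implicit.
Unset Printing Implicit Defensive.

Import Order.TTheory GRing.Theory Num.Theory.
Import numFieldNormedType.Exports.

Local Open Scope classical_set_scope.
Local Open Scope complex_scope.
Local Open Scope ring_scope.

(* The inner product of a complex Hilbert space; as for every [{dot _ for _}],
   it is linear in its first argument and conjugate-linear in the second. *)
HB.mixin Record isHilbert (R : realType) H & CompleteNormedModule R[i] H := {
  inner : {dot H for (@Num.conj R[i])} ;
  normr_inner : forall x : H, `|x| ^+ 2 = inner x x
}.

#[short(type="hilbertType")]
HB.structure Definition Hilbert (R : realType) :=
  {H of CompleteNormedModule R[i] H & isHilbert R H}.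

Notation "''[' x , y ]" := (inner x y) : ring_scope.

Record bop (R : realType) (U V : normedModType R[i]) := Bop {
  bop_fun :> U -> V ;
  bop_linear : linear bop_fun ;
  bop_bounded : exists M : R[i], forall x, `|bop_fun x| <= M * `|x|
}.

Section BoundedOperators.
Variables (R : realType) (U V : normedModType R[i]).
Local Notation bop := (bop U V).
Implicit Types (f g h : bop) (a b : R[i]) (x y : U).

HB.instance Definition _ := gen_eqMixin bop.
HB.instance Definition _ := gen_choiceMixin bop.

HB.instance Definition _ (f : bop) :=
  GRing.isLinear.Build R[i] U V *:%R f (@bop_linear _ _ _ f).

Lemma bopP f g : f =1 g -> f = g.
Proof.
case: f g => [f fl fb] [g gl gb] /= /funext fg.
by rewrite -{}fg in gl gb *; congr Bop; exact: Prop_irrelevance.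
Qed.

Fact bop_zero_linear : linear (fun _ : U => 0 : V).
Proof. by move=> a x y; rewrite scaler0 addr0. Qed.

Fact bop_zero_bounded : exists M : R[i], forall x, `|0 : V| <= M * `|x|.
Proof. by exists 0 => x; rewrite normr0 mul0r. Qed.

Definition bop_zero := Bop bop_zero_linear bop_zero_bounded.

Fact bop_opp_linear f : linear (fun x => - f x).
Proof. by move=> a x y; rewrite linearP opprD scalerN. Qed.

Fact bop_opp_bounded f : exists M : R[i], forall x, `|- f x| <= M * `|x|.
Proof. by have [M fM] := bop_bounded f; exists M => x; rewrite normrN. Qed.

Definition bop_opp f := Bop (bop_opp_linear f) (bop_opp_bounded f).

Fact bop_add_linear f g : linear (fun x => f x + g x).
Proof. by move=> a x y; rewrite !linearP scalerDr addrACA. Qed.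

Fact bop_add_bounded f g :
  exists M : R[i], forall x, `|f x + g x| <= M * `|x|.
Proof.
have [[M fM] [N gN]] := (bop_bounded f, bop_bounded g); exists (M + N) => x.
by rewrite mulrDl (le_trans (ler_normD _ _))// lerD.
Qed.

Definition bop_add f g := Bop (bop_add_linear f g) (bop_add_bounded f g).

Fact bop_scale_linear a f : linear (fun x => a *: f x).
Proof. by move=> b x y; rewrite linearP scalerDr !scalerA mulrC. Qed.

Fact bop_scale_bounded a f :
  exists M : R[i], forall x, `|a *: f x| <= M * `|x|.
Proof.
have [M fM] := bop_bounded f; exists (`|a| * M) => x.
by rewrite normrZ -mulrA ler_wpM2l.
Qed.

Definition bop_scale a f := Bop (bop_scale_linear a f) (bop_scale_bounded a f).

Fact bop_addA : associative bop_add.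
Proof. by move=> f g h; apply: bopP => x /=; rewrite addrA. Qed.

Fact bop_addC : commutative bop_add.
Proof. by move=> f g; apply: bopP => x /=; rewrite addrC. Qed.

Fact bop_add0 : left_id bop_zero bop_add.
Proof. by move=> f; apply: bopP => x /=; rewrite add0r. Qed.

Fact bop_addN : left_inverse bop_zero bop_opp bop_add.
Proof. by move=> f; apply: bopP => x /=; rewrite addNr. Qed.

HB.instance Definition _ :=
  GRing.isZmodule.Build bop bop_addA bop_addC bop_add0 bop_addN.

Fact bop_scaleA a b f : bop_scale a (bop_scale b f) = bop_scale (a * b) f.
Proof. by apply: bopP => x /=; rewrite scalerA. Qed.

Fact bop_scale1 : left_id 1 bop_scale.
Proof. by move=> f; apply: bopP => x /=; rewrite scale1r. Qed.

Fact bop_scaleDr : right_distributive bop_scale +%R.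
Proof. by move=> a f g; apply: bopP => x /=; rewrite scalerDr. Qed.

Fact bop_scaleDl f : {morph bop_scale^~ f : a b / a + b}.
Proof. by move=> a b; apply: bopP => x /=; rewrite scalerDl. Qed.

HB.instance Definition _ := GRing.Zmodule_isLmodule.Build R[i] bop
  bop_scaleA bop_scale1 bop_scaleDr bop_scaleDl.

(* Norms over [R[i]] take their values in [R[i]], whereas suprema exist in [R]. *)
Definition opnorm f : R[i] :=
  (sup [set complex.Re `|f x| | x in [set x : U | `|x| <= 1]])%:C.

Let ReK (z : R[i]) : 0 <= z -> (complex.Re z)%:C = z.
Proof. by case: z => a b; rewrite lecE/= => /andP[/eqP->]. Qed.

Let opnorm_ub f (M : R[i]) : (forall x, `|f x| <= M * `|x|) ->
  forall x, `|x| <= 1 -> complex.Re `|f x| <= complex.Re `|M|.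
Proof.
move=> fM x x1; rewrite -lecR !ReK//.
have [->|x0] := eqVneq x 0; first by rewrite linear0 normr0.
have M0 : 0 <= M.
  by rewrite -(@pmulr_lge0 _ `|x|) ?normr_gt0// (le_trans _ (fM x)).
by rewrite (ger0_norm M0) (le_trans (fM x))// ler_piMr.
Qed.

Lemma opnorm_bound f x : `|f x| <= opnorm f * `|x|.
Proof.
have [->|x0] := eqVneq x 0; first by rewrite linear0 !normr0 mulr0.
rewrite -ler_pdivrMr ?normr_gt0//.
have -> : `|f x| / `|x| = `|f (`|x|^-1 *: x)|.
  by rewrite linearZ/= normrZ normfV normr_id mulrC.
rewrite -[leLHS]ReK// lecR; apply: ub_le_sup.
  have [M fM] := bop_bounded f; exists (complex.Re `|M|) => _ [y /= y1 <-].
  exact: opnorm_ub.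
exists (`|x|^-1 *: x) => //=.
by rewrite normrZ normfV normr_id mulVf ?normr_eq0.
Qed.

Lemma opnorm_le f (M : R[i]) : 0 <= M ->
  (forall x, `|f x| <= M * `|x|) -> opnorm f <= M.
Proof.
move=> M0 fM; rewrite -[M]ger0_norm// -(ReK (normr_ge0 M)) /opnorm lecR.
apply: ge_sup; first by exists (complex.Re `|f 0|), 0 => //=; rewrite normr0.
by move=> _ [y /= y1 <-]; exact: opnorm_ub.
Qed.

Lemma opnorm_ge0 f : 0 <= opnorm f.
Proof.
rewrite /opnorm ler0c; have [M fM] := bop_bounded f.
apply: (@le_trans _ _ (complex.Re `|f 0|)); first by rewrite -ler0c ReK.
apply: ub_le_sup; last by exists 0 => //=; rewrite normr0.
exists (complex.Re `|M|) => _ [y /= y1 <-]; exact: opnorm_ub.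
Qed.

Fact opnormD f g : opnorm (f + g) <= opnorm f + opnorm g.
Proof.
apply: opnorm_le => [|x]; first by rewrite addr_ge0 ?opnorm_ge0.
by rewrite mulrDl (le_trans (ler_normD _ _))// lerD ?opnorm_bound.
Qed.

Fact opnormZ a f : opnorm (a *: f) = `|a| * opnorm f.
Proof.
have leZ b g : opnorm (b *: g) <= `|b| * opnorm g.
  apply: opnorm_le => [|x]; first by rewrite mulr_ge0 ?opnorm_ge0.
  by rewrite normrZ -mulrA ler_wpM2l ?opnorm_bound.
apply/eqP; rewrite eq_le leZ /=; have [->|a0] := eqVneq a 0.
  by rewrite normr0 mul0r opnorm_ge0.
rewrite -ler_pdivlMl ?normr_gt0// -normfV.
by have := leZ a^-1 (a *: f); rewrite scalerA mulVf// scale1r.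
Qed.

Fact opnorm0_eq0 f : opnorm f = 0 -> f = 0.
Proof.
move=> f0; apply: bopP => x /=; apply/eqP; rewrite -normr_le0.
by have := opnorm_bound f x; rewrite f0 mul0r.
Qed.

HB.instance Definition _ :=
  Lmodule_isNormed.Build R[i] bop opnormD opnormZ opnorm0_eq0.

Lemma bop_normE f : `|f| = opnorm f. Proof. by []. Qed.

End BoundedOperators.

Notation "''B' ( K )" := (bop K K) (at level 8, format "''B' ( K )").

Section Cones.
Variables (R : realType) (V : lmodType R[i]).
Implicit Types (C F : set V) (u v w : V).

(* In the order of [R[i]], [0 <= a] says that [a] is a nonnegative real. *)
Definition is_cone C :=
  [/\ C !=set0,
      forall u v, C u -> C v -> C (u + v) &
      forall (a : R[i]) v, 0 <= a -> C v -> C (a *: v)].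

(* [C v] and [C (w - v)] express [0 <= v] and [v <= w] in the order of [C]. *)
Definition is_face C F :=
  [/\ F `<=` C, is_cone F & forall v w, C v -> C (w - v) -> F w -> F v].

Definition ray v : set V := [set a *: v | a in [set a : R[i] | 0 <= a]].

Definition extremal C v := C v /\ is_face C (ray v).

End Cones.

Section PositiveMaps.
Variable R : realType.
Implicit Types (G K H : hilbertType R).

Definition positive_op G : set 'B(G) := [set A | forall x, 0 <= '[A x, x]].

Definition positive_map K H : set (bop 'B(K) 'B(H)) :=
  [set phi | forall A, positive_op A -> positive_op (phi A)].

(* A [k x k] matrix of operators on [G] is an operator on the direct sum of
   [k] copies of [G], whose elements are the families [x : 'I_k -> G]. *)
Definition opmx_apply G k (A : 'M['B(G)]_k) (x : 'I_k -> G) (i : 'I_k) : G :=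
  \sum_(j < k) A i j (x j).

Definition dsum_inner G k (x y : 'I_k -> G) : R[i] := \sum_(i < k) '[x i, y i].

Definition positive_opmx G k : set 'M['B(G)]_k :=
  [set A | forall x : 'I_k -> G, 0 <= dsum_inner (opmx_apply A x) x].

Definition amplification K H k (phi : bop 'B(K) 'B(H)) (A : 'M['B(K)]_k) :
  'M['B(H)]_k := \matrix_(i, j) phi (A i j).

Definition coamplification K H k (phi : bop 'B(K) 'B(H)) (A : 'M['B(K)]_k) :
  'M['B(H)]_k := \matrix_(i, j) phi (A j i).

Definition k_positive K H k (phi : bop 'B(K) 'B(H)) :=
  forall A : 'M['B(K)]_k, positive_opmx A -> positive_opmx (amplification phi A).

Definition k_copositive K H k (phi : bop 'B(K) 'B(H)) :=
  forall A : 'M['B(K)]_k,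
    positive_opmx A -> positive_opmx (coamplification phi A).

Definition completely_positive K H (phi : bop 'B(K) 'B(H)) :=
  forall k, k_positive k phi.

Definition completely_copositive K H (phi : bop 'B(K) 'B(H)) :=
  forall k, k_copositive k phi.

End PositiveMaps.

(* Main.v *)
Require Import Defs.
From HB Require Import structures.
From mathcomp Require Import all_boot all_order all_algebra complex.
From mathcomp Require Import boolp classical_sets reals topology normedtype.
From mathcomp Require Import ring.
Import Order.TTheory GRing.Theory Num.Theory.
Import numFieldNormedType.Exports.
Local Open Scope ring_scope.

(** Fix a vector [y] with [phi 1 y != 0] and consider the state
    [omega a = '[phi a y, y]] on [B(K)], with GNS representation [pi] on the
    Hilbert space [L], the completion of [B(K)] for [omega (b^* a)].
    2-positivity gives the Schwarz inequality
    [ |'[phi (a b) y, z]|^2 <= '[phi a z, z] * omega (b^* a b) ] for [a >= 0].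
    For [a = 1] it says that [b |-> phi b y] extends to a bounded operator
    [V : L -> H].  The map [psi a = V (pi a) V^*] is completely positive, being
    a compression of a representation.  It is also dominated by [phi]: letting
    the class of [b] tend to [V^* z] in the Schwarz inequality, written as
    [0 <= '[phi a z, z] - 2 Re '[phi (a b) y, z] + omega (b^* a b)], gives
    [0 <= '[phi a z, z] - '[psi a z, z]].  Since [phi] is extremal, [psi] is a
    multiple of [phi]; since [psi 1 y = phi 1 y != 0], the multiple is not zero,
    so [phi] is completely positive as well.  A suitable [y] exists because the
    Schwarz inequality for [a = 1] gives [phi = 0] if [phi 1 = 0].  The state
    [omega] may vanish on all compact operators, and so [L] cannot be replaced
    by [K] and [psi] by a map [a |-> B a B^*].

    The space [L] is not constructed.  A vector [V^* z] is replaced by the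
    operators [b] whose class is within [d] of it, for every [d > 0]
    ([approx]); they exist by an approximate Riesz representation
    ([ex_represents]), and [psi a z] is the limit of [phi (a b) y] in the
    complete space [H] as [d] tends to 0 ([minorant], [minorant_approx]).
    Complete positivity ([minorant_twisted_positive]) and domination
    ([minorant_le]) then follow from inequalities between such approximations.

    A copositive map on [B(K)] is a positive map on the opposite algebra, and
    the argument uses only the product, the adjoint and the order of [B(K)].  It
    is therefore carried out once, for the product [twist c], which is
    composition or composition in the reverse order. *)

Set Implicit Arguments.
Unset Strict Implicit.
Unset Printing Implicit Defensive.

(** * Positive sesquilinear forms *)

Section Scalars.
Variable C : numClosedFieldType.
Implicit Types a e g t b c s : C.

(** The discriminant criterion for a real quadratic function with a degenerate
    leading coefficient allowed; [t = g^-1] is the optimal point. *)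
Lemma quad_bound a e g : 0 <= e -> 0 <= g ->
  (forall t, 0 <= t -> 2 * t * e - t ^+ 2 * e * g <= a) -> e <= a * g.
Proof.
move=> e0 g0 le_a.
have a0 : 0 <= a by have := le_a 0 (lexx 0); rewrite mulr0 expr0n !mul0r subr0.
have [g_eq0|gN0] := eqVneq g 0; last first.
  have gi0 : 0 <= g^-1 by rewrite invr_ge0.
  have := le_a g^-1 gi0.
  have -> : 2 * g^-1 * e - g^-1 ^+ 2 * e * g = e / g by field.
  by rewrite ler_pdivrMr// lt0r gN0.
have [->|eN0] := eqVneq e 0; first by rewrite mulr_ge0.
have := le_a ((a + 1) / e); rewrite divr_ge0 ?addr_ge0// => /(_ isT).
have -> : 2 * ((a + 1) / e) * e - ((a + 1) / e) ^+ 2 * e * g = a + (a + 2).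
  by rewrite g_eq0; field.
by rewrite gerDl => /(lt_le_trans (ltr_pwDr (ltr0Sn _ 1) a0)); rewrite ltxx.
Qed.

(** Nonnegativity on the vectors [(1, - s)] alone forces a 2 x 2 form to be
    hermitian, by the imaginary parts at [s = 1] and [s = 'i], and to have a
    nonnegative determinant, by [quad_bound] along [s = t * b^*]. *)
Lemma psd2P a b c g : 0 <= g ->
  (forall s, 0 <= a - s * b - s^* * c + s * s^* * g) ->
  c = b^* /\ `|b| ^+ 2 <= a * g.
Proof.
move=> g0 psd.
have a0 : 0 <= a by have := psd 0; rewrite conjC0 !mul0r !subr0 addr0.
have aJ : a^* = a by apply/CrealP/ger0_real.
have gJ : g^* = g by apply/CrealP/ger0_real.
have cE : c = b^*.
  have /ger0_real/CrealP := psd 1; have /ger0_real/CrealP := psd 'i.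
  rewrite !(rmorphB, rmorphD, rmorphM, rmorph1) /= conjCK conjCi aJ gJ.
  move=> /eqP + /eqP; rewrite -subr_eq0 => /eqP h1.
  rewrite -subr_eq0 => /eqP h2.
  have h3 : 'i * (b^* - c^* + b - c) = 0 by rewrite -h1; ring.
  have {}h3 : b^* - c^* + b - c = 0.
    by apply/eqP; move/eqP: h3; rewrite mulf_eq0 (negbTE (neq0Ci C)).
  have h4 : c * 2 = b^* * 2.
    apply/eqP; rewrite -subr_eq0; apply/eqP.
    by rewrite -[RHS]subr0 -[X in _ = X - _]h2 -[X in _ = _ - X]h3; ring.
  by apply: mulIf h4; rewrite pnatr_eq0.
split=> //; apply: quad_bound => [|//|t t0]; first by rewrite exprn_ge0.
have tJ : t^* = t by apply/CrealP/ger0_real.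
have := psd (t * b^*); rewrite cE rmorphM /= conjCK tJ normCK.
move=> h; rewrite -subr_ge0; apply: le_trans h _; rewrite le_eqVlt.
by apply/orP; left; apply/eqP; ring.
Qed.

End Scalars.

Section Forms.
Variables (R : realType) (E : lmodType R[i]).
Local Notation C := R[i].
Variable q : {bilinear E -> E -> C | *%R & Num.conj \; *%R}.
Hypothesis q_ge0 : forall x, 0 <= q x x.
Implicit Types (x y b c : E) (f : E -> C) (d M : C).

Lemma form_expand x y s :
  q (x - s *: y) (x - s *: y) =
    q x x - s * q y x - s^* * q x y + s * s^* * q y y.
Proof.
rewrite linearBl !linearBr !linearZl_LR !linearZr_LR /=; ring.
Qed.

Lemma formC x y : q y x = (q x y)^*.
Proof.
have [] := @psd2P _ (q x x) (q y x) (q x y) (q y y) (q_ge0 y).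
  by move=> s; rewrite -form_expand.
by move=> -> _; rewrite conjCK.
Qed.

Definition seminorm x := sqrtC (q x x).

Lemma seminorm_ge0 x : 0 <= seminorm x. Proof. by rewrite sqrtC_ge0. Qed.

Lemma sqr_seminorm x : seminorm x ^+ 2 = q x x. Proof. exact: sqrtCK. Qed.

Lemma form_CauchySchwarz x y : `|q x y| <= seminorm x * seminorm y.
Proof.
have [] := @psd2P _ (q x x) (q y x) (q x y) (q y y) (q_ge0 y).
  by move=> s; rewrite -form_expand.
move=> -> le_q; rewrite norm_conjC -(ler_pXn2r (ltn0Sn 1)) ?nnegrE //.
  by rewrite exprMn !sqr_seminorm.
by rewrite mulr_ge0 ?seminorm_ge0.
Qed.

(** The dual norm of [f - q(., b)] is at most [d].  The family of all such [b],
    for every [d > 0], stands for the vector of the completion of [E] that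
    represents [f]. *)
Definition represents f d b := forall c, `|f c - q c b| <= d * seminorm c.

(** Both estimates are used at [c = b - b']. *)
Lemma represents_dist f d d' b b' : 0 <= d -> 0 <= d' ->
  represents f d b -> represents f d' b' -> seminorm (b - b') <= d + d'.
Proof.
move=> d0 d'0 fb fb'; set n := seminorm _.
have n0 : 0 <= n by exact: seminorm_ge0.
have [->|nN0] := eqVneq n 0; first by rewrite addr_ge0.
have n_gt0 : 0 < n by rewrite lt0r nN0.
rewrite -(ler_pM2r n_gt0) -expr2 sqr_seminorm mulrDl.
rewrite -(ger0_norm (q_ge0 _)) linearBr /= [q _ b - _](_ : _ =
  - (f (b - b') - q (b - b') b) + (f (b - b') - q (b - b') b')); last by ring.
by rewrite (le_trans (ler_normD _ _))// normrN lerD.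
Qed.

(** Any [b] that maximizes [2 Re (f b) - q b b] up to [d ^+ 2] will do: adding
    [- s *: c] to it cannot gain more than [d ^+ 2], and [psd2P] turns this into
    a bound on [f c - q c b]. *)
Lemma ex_represents f d M : scalar f -> 0 <= M ->
  (forall x, `|f x| <= M * seminorm x) -> 0 < d -> exists b, represents f d b.
Proof.
move=> f_lin M0 fM d0.
pose g x : C := f x + (f x)^* - q x x.
have gJ x : (complex.Re (g x))%:C%C = g x.
  apply: RRe_real; rewrite CrealE /g rmorphB rmorphD /= conjCK -formC.
  by rewrite [_^* + _]addrC.
have g_le x : g x <= M ^+ 2.
  have fE : f x + (f x)^* <= 2 * (M * seminorm x).
    rewrite (le_trans (real_ler_norm _)) //.
      by rewrite CrealE rmorphD /= conjCK addrC.
    rewrite (le_trans (ler_normD _ _)) // norm_conjC -mulr2n -[leLHS]mulr_natl.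
    by rewrite ler_pM2l ?ltr0Sn.
  rewrite /g -sqr_seminorm lerBlDr (le_trans fE) // -subr_ge0.
  have : 0 <= (M - seminorm x) ^+ 2.
    by rewrite real_exprn_even_ge0 // rpredB // ger0_real ?seminorm_ge0.
  move/le_trans; apply; rewrite le_eqVlt; apply/orP; left; apply/eqP; ring.
pose S := [set complex.Re (g x) | x in [set: E]]%classic.
have S_sup : has_sup S.
  split; first by exists (complex.Re (g 0)), 0.
  exists (complex.Re (M ^+ 2)) => _ [x _ <-].
  by rewrite -lecR gJ RRe_real ?g_le // ger0_real ?exprn_ge0.
have d2J : (complex.Re (d ^+ 2))%:C%C = d ^+ 2.
  by rewrite RRe_real // gtr0_real ?exprn_gt0.
have d2_gt0 : 0 < complex.Re (d ^+ 2) by rewrite -ltcR d2J exprn_gt0.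
have [_ [b _ <-] lt_b] := sup_adherent d2_gt0 S_sup.
exists b => c.
have g_max x : g x <= g b + d ^+ 2.
  rewrite -gJ -(gJ b) -d2J -rmorphD /= lecR -lerBlDr (le_trans _ (ltW lt_b))//.
  by rewrite lerD2r; apply: sup_upper_bound => //; exists x.
have [] := @psd2P _ (d ^+ 2) (- (f c - q c b)) (- (f c - q c b))^* (q c c)
  (q_ge0 c).
  move=> s; have := g_max (b - s *: c); rewrite -subr_ge0 => /le_trans -> //.
  rewrite /g form_expand (formC c b).
  have -> : f (b - s *: c) = f b - s * f c.
    by rewrite addrC -scaleNr f_lin mulNr addrC.
  rewrite !(rmorphB, rmorphM, rmorphN) /=; rewrite le_eqVlt.
  by apply/orP; left; apply/eqP; ring.
move=> _; rewrite normrN -sqr_seminorm -exprMn ler_pXn2r ?nnegrE //.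
by rewrite mulr_ge0 ?seminorm_ge0 // ltW.
Qed.

End Forms.

(** * Limits along a vanishing error *)

Section SmallErrors.
Variable F : numFieldType.
Implicit Types (V : normedZmodType F) (x y c d : F).

Lemma le_of_small x y c :
  0 <= c -> (forall d, 0 < d -> x <= y + c * d) -> x <= y.
Proof.
move=> c0 le_x; apply/ler_addgt0Pr => e e0.
have c1 : 0 < c + 1 by rewrite ltr_wpDl.
have := le_x (e / (c + 1)); rewrite divr_gt0 // => /(_ isT) /le_trans; apply.
rewrite lerD2l mulrA ler_pdivrMr // mulrC ler_pM2l //.
by rewrite lerDl.
Qed.

Lemma eq0_of_small V (x : V) c : 0 <= c -> (forall d, 0 < d -> `|x| <= c * d) ->
  x = 0.
Proof.
move=> c0 le_x; apply/eqP; rewrite -normr_le0.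
by apply: (le_of_small c0) => d d0; rewrite add0r le_x.
Qed.

(** The cone of nonnegative scalars is closed.  Bounding [d] by 1 lets the
    callers absorb the terms quadratic in [d]. *)
Lemma ge0_of_small x c : 0 <= c ->
  (forall d, 0 < d -> d <= 1 -> exists2 p, 0 <= p & `|x - p| <= c * d) ->
  0 <= x.
Proof.
move=> c0 near_x; suff -> : x = `|x| by [].
apply/subr0_eq/(@eq0_of_small _ _ (2 * c)) => [|d d0].
  by rewrite mulr_ge0.
have d1_gt0 : 0 < 1 + d by rewrite addr_gt0.
have [|| p p0 xp] := near_x (d / (1 + d)).
- by rewrite divr_gt0.
- by rewrite ler_pdivrMr // mul1r lerDr.
have {}xp : `|x - p| <= c * d.
  rewrite (le_trans xp) // ler_wpM2l // ler_pdivrMr //.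
  by apply: ler_peMr; rewrite ?lerDl ltW.
have -> : x - `|x| = (x - p) - (`|x| - `|p|) by rewrite (ger0_norm p0); ring.
rewrite (le_trans (ler_normB _ _)) // -mulrA mulr_natl mulr2n lerD //.
by rewrite (le_trans (ler_dist_dist _ _)).
Qed.

End SmallErrors.

(** The sets [S d] play the part of the balls of a Cauchy filter; the error
    bound passes to its limit. *)
Lemma ex_small_limit (R : realType) (V : completeNormedModType R[i])
    (S : R[i] -> set V) (c : R[i]) : 0 <= c ->
  (forall d, 0 < d -> S d !=set0)%classic ->
  (forall d d', 0 < d -> d <= d' -> S d `<=` S d')%classic ->
  (forall d d' x x', 0 < d -> 0 < d' -> S d x -> S d' x' ->
    `|x - x'| <= c * (d + d')) ->
  exists h, forall d x, 0 < d -> S d x -> `|x - h| <= c * d.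
Proof.
move=> c0 S_neq0 S_mono S_dist.
pose F : set_system V := [set A | exists2 d, 0 < d & S d `<=` A]%classic.
have S_cap d d' : 0 < d -> 0 < d' ->
    exists2 e, 0 < e & (S e `<=` S d /\ S e `<=` S d')%classic.
  move=> d0 d'0; have dd' := addr_gt0 d0 d'0.
  have e0 : 0 < d * d' / (d + d') by rewrite divr_gt0 ?mulr_gt0.
  exists (d * d' / (d + d')) => //; split; apply: S_mono => //.
    by rewrite ler_pdivrMr // ler_pM2l // lerDr ltW.
  by rewrite ler_pdivrMr // mulrC ler_pM2l // lerDl ltW.
have FF : ProperFilter F.
  apply: Build_ProperFilter_ex => [A [d d0 SA]|].
    by have [x Sx] := S_neq0 d d0; exists x; exact: SA.
  split=> [|A B [d d0 SA] [d' d'0 SB]|A B AB [d d0 SA]].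
  - by exists 1.
  - have [e e0 [Sd Sd']] := S_cap d d' d0 d'0.
    by exists e => // x Sx; split; [apply/SA/Sd | apply/SB/Sd'].
  - by exists d => // x /SA /AB.
have F_cauchy : cauchy F.
  apply: cauchy_exP => e e0.
  pose d := e / (c * 2 + 1).
  have c1 : 0 < c * 2 + 1 by rewrite ltr_wpDl ?mulr_ge0.
  have d0 : 0 < d by rewrite divr_gt0.
  have [x Sx] := S_neq0 d d0.
  exists x, d => // x' Sx'; rewrite -ball_normE /ball_ /=.
  rewrite (le_lt_trans (S_dist d d x x' d0 d0 Sx Sx')) //.
  rewrite -mulr2n -mulr_natl mulrA /d mulrA ltr_pdivrMr // mulrC ltr_pM2l //.
  by rewrite ltrDl.
have [h Fh] : exists h : V, (F --> h)%classic.
  by apply/cvg_ex; exact: cauchy_cvg F_cauchy.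
exists h => d x d0 Sx; apply: (@le_of_small _ _ _ (c + 1)).
  by rewrite addr_ge0.
move=> e e0.
have [d' d'0 Sd'] : F (ball h e) by apply: Fh; exact: nbhsx_ballx.
have [k k0 [Sk Sk']] := S_cap e d' e0 d'0.
have [x' Sx'] := S_neq0 k k0.
have := Sd' x' (Sk' x' Sx'); rewrite -ball_normE /ball_ /= => hx'.
have -> : x - h = (x - x') - (h - x') by rewrite opprB addrA subrK.
rewrite (le_trans (ler_normB _ _)) // mulrDl mul1r addrA lerD ?(ltW hx') //.
by rewrite -mulrDr (S_dist d e x x' d0 e0 Sx) //; exact: Sk.
Qed.

(** * Operators on a Hilbert space *)

Section Hilbert.
Variables (R : realType) (G : hilbertType R).
Local Notation C := R[i].
Implicit Types (x y z : G) (d M : C).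

(** The inner product without its symmetry, so that the results on positive
    sesquilinear forms apply to it. *)
Definition inner_form : {bilinear G -> G -> C | *%R & Num.conj \; *%R} :=
  @inner R G.

Lemma inner_ge0 x : 0 <= '[x, x].
Proof. by rewrite -normr_inner exprn_ge0. Qed.

Lemma inner_conj x y : '[y, x] = '[x, y]^*.
Proof. exact: (@formC _ _ inner_form inner_ge0). Qed.

Lemma seminorm_inner x : seminorm inner_form x = `|x|.
Proof.
apply: (@pexpIrn _ 2) => //; rewrite ?nnegrE ?normr_ge0 //.
  exact: seminorm_ge0 inner_ge0 x.
by rewrite sqr_seminorm normr_inner.
Qed.

Lemma inner_le x y : `|'[x, y]| <= `|x| * `|y|.
Proof.
by rewrite -!seminorm_inner (@form_CauchySchwarz _ _ inner_form inner_ge0).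
Qed.

Lemma inner_inj x y : (forall z, '[z, x] = '[z, y]) -> x = y.
Proof.
move=> xy; apply/subr0_eq/eqP; rewrite -normr_eq0 -sqrf_eq0 normr_inner.
by rewrite linearBr /= xy subrr.
Qed.

(** The Riesz representation theorem: the approximate representatives form a
    Cauchy family. *)
Lemma ex_riesz (f : G -> C) M : scalar f -> 0 <= M ->
  (forall x, `|f x| <= M * `|x|) -> exists y, forall x, f x = '[x, y].
Proof.
move=> f_lin M0 fM.
have fM' x : `|f x| <= M * seminorm inner_form x by rewrite seminorm_inner.
have [|||h hP] := @ex_small_limit R G (represents inner_form f) 1 ler01.
- move=> d d0; have [b fb] := ex_represents inner_ge0 f_lin M0 fM' d0.
  by exists b.
- move=> d d' d0 dd' b fb c; rewrite (le_trans (fb c)) // ler_wpM2r //.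
  exact: seminorm_ge0 inner_ge0 c.
- move=> d d' b b' d0 d'0 fb fb'; rewrite mul1r -seminorm_inner.
  by apply: (represents_dist inner_ge0) fb fb'; exact: ltW.
exists h => x; apply/subr0_eq/(@eq0_of_small _ _ _ (2 * `|x|)).
  by rewrite mulr_ge0.
move=> d d0; have [b fb] := ex_represents inner_ge0 f_lin M0 fM' d0.
have -> : f x - '[x, h] = (f x - '[x, b]) + '[x, b - h].
  by rewrite linearBr /= addrA subrK.
rewrite (le_trans (ler_normD _ _)) // mulrAC mulr_natl mulr2n mulrDl lerD //.
  by rewrite -seminorm_inner; exact: fb.
rewrite (le_trans (inner_le _ _)) // mulrC ler_wpM2r //.
by have := hP d b d0 fb; rewrite mul1r.
Qed.

End Hilbert.

Section Operators.
Variables (R : realType) (G : hilbertType R).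
Local Notation C := R[i].
Implicit Types (x y z : G) (a b : 'B(G)).

Lemma bop_le a x : `|a x| <= `|a| * `|x|.
Proof. exact: opnorm_bound. Qed.

Fact bop_comp_linear a b : linear (a \o b).
Proof. by move=> k x y; rewrite /= !linearP. Qed.

Fact bop_comp_bounded a b : exists M : C, forall x, `|(a \o b) x| <= M * `|x|.
Proof.
exists (`|a| * `|b|) => x /=; rewrite (le_trans (bop_le _ _)) // -mulrA.
by rewrite ler_wpM2l // bop_le.
Qed.

Definition bop_comp a b : 'B(G) :=
  Bop (bop_comp_linear a b) (bop_comp_bounded a b).

Fact bop_id_linear : linear (@id G).
Proof. by []. Qed.

Fact bop_id_bounded : exists M : C, forall x, `|x| <= M * `|x|.
Proof. by exists 1 => x; rewrite mul1r. Qed.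

Definition bop_id : 'B(G) := Bop bop_id_linear bop_id_bounded.

Lemma ex_adjoint a : exists b, forall x y, '[a x, y] = '[x, b y].
Proof.
have ex_y y : exists z, forall x, '[a x, y] = '[x, z].
  apply: (@ex_riesz _ _ _ (`|a| * `|y|)) => [k x x'||x]; last first.
  - rewrite (le_trans (inner_le _ _)) // mulrAC ler_wpM2r //; exact: bop_le.
  - by rewrite mulr_ge0.
  - by rewrite linearP linearPl.
pose g y := projT1 (cid (ex_y y)).
have gE x y : '[a x, y] = '[x, g y] by exact: (projT2 (cid (ex_y y))).
have g_lin : linear g.
  move=> k y y'; apply: inner_inj => x.
  by rewrite -gE !linearPr /= -!gE.
have g_bd : exists M : C, forall y, `|g y| <= M * `|y|.
  exists `|a| => y; have [->|gN0] := eqVneq (g y) 0.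
    by rewrite normr0 mulr_ge0.
  have g_gt0 : 0 < `|g y| by rewrite normr_gt0.
  rewrite -(ler_pM2r g_gt0) -expr2 normr_inner.
  rewrite (le_trans (real_ler_norm _)) ?ger0_real ?inner_ge0 //.
  rewrite -gE (le_trans (inner_le _ _)) // mulrAC ler_wpM2r //; exact: bop_le.
by exists (Bop g_lin g_bd).
Qed.

Definition adjoint a : 'B(G) := projT1 (cid (ex_adjoint a)).

Lemma adjointE a x y : '[a x, y] = '[x, adjoint a y].
Proof. exact: (projT2 (cid (ex_adjoint a))). Qed.

Lemma adjointEr a x y : '[adjoint a x, y] = '[x, a y].
Proof. by rewrite inner_conj -adjointE -inner_conj. Qed.

Lemma adjoint_unique a b :
  (forall x y, '[a x, y] = '[x, b y]) -> b = adjoint a.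
Proof.
by move=> ab; apply: bopP => y; apply: inner_inj => x; rewrite -ab adjointE.
Qed.

Lemma adjointK a : adjoint (adjoint a) = a.
Proof. by symmetry; apply: adjoint_unique => x y; rewrite adjointEr. Qed.

Lemma adjoint_conj_linear (k : C) a b :
  adjoint (k *: a + b) = k^* *: adjoint a + adjoint b.
Proof.
symmetry; apply: adjoint_unique => x y /=.
by rewrite linearPl linearPr /= conjCK !adjointE.
Qed.

Lemma adjoint_id : adjoint bop_id = bop_id.
Proof. by symmetry; apply: adjoint_unique. Qed.

Lemma adjoint_comp a b :
  adjoint (bop_comp a b) = bop_comp (adjoint b) (adjoint a).
Proof. by symmetry; apply: adjoint_unique => x y /=; rewrite !adjointE. Qed.

Lemma adjoint_norm a : `|adjoint a| <= `|a|.
Proof.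
apply: opnorm_le => // y; have [->|gN0] := eqVneq (adjoint a y) 0.
  by rewrite normr0 mulr_ge0.
have g_gt0 : 0 < `|adjoint a y| by rewrite normr_gt0.
rewrite -(ler_pM2r g_gt0) -expr2 normr_inner.
rewrite (le_trans (real_ler_norm _)) ?ger0_real ?inner_ge0 //.
rewrite -adjointE (le_trans (inner_le _ _)) // mulrAC ler_wpM2r //.
exact: bop_le.
Qed.

Lemma pos_id : positive_op bop_id.
Proof. by move=> x; exact: inner_ge0. Qed.

Lemma psd_const a : positive_op a -> positive_opmx (const_mx a : 'M['B(G)]_1).
Proof.
by move=> a0 x; rewrite /dsum_inner /opmx_apply !big_ord1 mxE; exact: a0.
Qed.

(** The matrix is [u^* a u] for the row [u], seen as an operator from the direct
    sum of [k] copies of [G] to [G]. *)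
Lemma psd_of_row k a (u : 'I_k -> 'B(G)) : positive_op a ->
  positive_opmx (\matrix_(i, j) bop_comp (adjoint (u i)) (bop_comp a (u j))).
Proof.
move=> a0 x; rewrite /dsum_inner /opmx_apply.
suff -> : \sum_(i < k) '[\sum_(j < k) (\matrix_(i, j)
    bop_comp (adjoint (u i)) (bop_comp a (u j))) i j (x j), x i] =
  '[a (\sum_j u j (x j)), \sum_i u i (x i)] by exact: a0.
rewrite linear_sumr /=; apply: eq_bigr => i _.
rewrite linear_sum !linear_sumlz /=; apply: eq_bigr => j _.
by rewrite mxE /= adjointEr.
Qed.

Lemma bop_sumE (V W : normedModType C) (I : Type) (r : seq I) (P : pred I)
    (F : I -> bop V W) (x : V) :
  (\sum_(i <- r | P i) F i) x = \sum_(i <- r | P i) F i x.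
Proof. by apply: (big_morph (fun f : bop V W => f x)). Qed.

(** The operator is [v^* A v] for the column [v] of the [u i]. *)
Lemma pos_of_psd k (A : 'M['B(G)]_k) (u : 'I_k -> 'B(G)) : positive_opmx A ->
  positive_op (\sum_i \sum_j bop_comp (adjoint (u i)) (bop_comp (A i j) (u j))).
Proof.
move=> A0 x; have := A0 (fun i => u i x); rewrite /dsum_inner /opmx_apply.
rewrite bop_sumE linear_sumlz; congr (0 <= _); apply: eq_bigr => i _.
rewrite bop_sumE !linear_sumlz; apply: eq_bigr => j _.
by rewrite /= adjointEr.
Qed.

(** The product of the operator algebra, or that of the opposite algebra: a
    copositive map on the former is a positive map on the latter. *)
Definition twist (c : bool) a b := if c then bop_comp b a else bop_comp a b.

Fact twist_bilinear c : bilinear_for *:%R *:%R (twist c).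
Proof.
by split=> [b|a] k b1 b2; case: c; apply: bopP => x //=; rewrite linearP.
Qed.

HB.instance Definition _ c := bilinear_isBilinear.Build C 'B(G) 'B(G) 'B(G)
  *:%R *:%R (twist c) (twist_bilinear c).

Lemma twistA c a b b' : twist c a (twist c b b') = twist c (twist c a b) b'.
Proof. by case: c; apply: bopP. Qed.

Lemma twist1l c b : twist c bop_id b = b.
Proof. by case: c; apply: bopP. Qed.

Lemma twist1r c b : twist c b bop_id = b.
Proof. by case: c; apply: bopP. Qed.

Lemma adjoint_twist c a b :
  adjoint (twist c a b) = twist c (adjoint b) (adjoint a).
Proof. by case: c; rewrite /twist adjoint_comp. Qed.

(** The operator inequality [a^* a <= |a|^2], for either product: reversing the
    product exchanges [a] and its adjoint, which has no larger norm. *)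
Lemma norm_bound_pos c a :
  positive_op (`|a| ^+ 2 *: bop_id - twist c (adjoint a) a).
Proof.
have main b : `|b| <= `|a| ->
    positive_op (`|a| ^+ 2 *: bop_id - bop_comp (adjoint b) b).
  move=> ba x; rewrite linearBl /= linearZl_LR /= adjointEr -!normr_inner.
  rewrite subr_ge0 -exprMn ler_pXn2r ?nnegrE ?mulr_ge0 //.
  by rewrite (le_trans (bop_le _ _)) // ler_wpM2r.
case: c => /=; last exact: main.
by have := main (adjoint a) (adjoint_norm a); rewrite adjointK.
Qed.

End Operators.

Section TwistedPositivity.
Variables (R : realType) (K H : hilbertType R) (c : bool).
Local Notation C := R[i].
Local Notation mul := (@twist R K c).
Implicit Types (a b : 'B(K)) (phi : bop 'B(K) 'B(H)).

Definition twisted_k_positive k phi :=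
  if c then k_copositive k phi else k_positive k phi.

Lemma twisted_k_positiveP k phi : twisted_k_positive k phi <->
  forall A : 'M['B(K)]_k, positive_opmx A -> forall x : 'I_k -> H,
    0 <= \sum_i \sum_j '[phi (if c then A j i else A i j) (x j), x i].
Proof.
rewrite /twisted_k_positive; case: c; split=> phi_pos A A0 x;
  have := phi_pos A A0 x; congr (0 <= _); rewrite /dsum_inner /opmx_apply;
  apply: eq_bigr => i _; rewrite linear_sumlz; apply: eq_bigr => j _;
  by rewrite mxE.
Qed.

(** For the opposite product, congruence by the row [v] is congruence by the row
    of adjoints for composition, with the matrix transposed. *)
Definition twist_row k (v : 'I_k -> 'B(K)) i :=
  if c then adjoint (v i) else v i.

Lemma twist_row_entry k (v : 'I_k -> 'B(K)) a i j :
  let w := twist_row v in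
  mul (adjoint (v i)) (mul a (v j)) =
    if c then bop_comp (adjoint (w j)) (bop_comp a (w i))
    else bop_comp (adjoint (w i)) (bop_comp a (w j)).
Proof.
by rewrite /twist_row /twist; case: c => /=; rewrite ?adjointK //; exact: bopP.
Qed.

Lemma twisted_1_positive phi : twisted_k_positive 1 phi -> positive_map phi.
Proof.
move=> /twisted_k_positiveP phi1 a a0 z.
by have := phi1 _ (psd_const a0) (fun=> z); rewrite !big_ord1 !mxE; case: c.
Qed.

Lemma twisted_k_positiveZ k phi (s : C) : 0 <= s ->
  twisted_k_positive k phi -> twisted_k_positive k (s *: phi).
Proof.
move=> s0 /twisted_k_positiveP phik; apply/twisted_k_positiveP => A A0 x.
have := mulr_ge0 s0 (phik A A0 x); congr (0 <= _).
rewrite mulr_sumr; apply: eq_bigr => i _; rewrite mulr_sumr.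
by apply: eq_bigr => j _; rewrite /= linearZl_LR.
Qed.

(** Apply the amplification of [phi] to the positive matrix of [psd_of_row]. *)
Lemma twisted_positive_row phi k a (v : 'I_k -> 'B(K)) (x : 'I_k -> H) :
  twisted_k_positive k phi -> positive_op a ->
  0 <= \sum_i \sum_j '[phi (mul (adjoint (v i)) (mul a (v j))) (x j), x i].
Proof.
move=> /twisted_k_positiveP phi_pos a0.
have := phi_pos _ (psd_of_row (twist_row v) a0) x.
congr (0 <= _); apply: eq_bigr => i _; apply: eq_bigr => j _.
by rewrite twist_row_entry !mxE.
Qed.

Lemma twisted_sum_pos k (A : 'M['B(K)]_k) (v : 'I_k -> 'B(K)) :
  positive_opmx A -> positive_op
    (\sum_i \sum_j
      mul (adjoint (v i)) (mul (if c then A j i else A i j) (v j))).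
Proof.
move=> /(pos_of_psd (twist_row v)); congr positive_op.
under [RHS]eq_bigr do under eq_bigr do rewrite twist_row_entry /=.
by case: c => //=; rewrite exchange_big.
Qed.

(** The case of the row [(1, b)] and the vector [(z, - s w)]. *)
Lemma two_positive_psd phi a b (z w : H) (s : C) :
  twisted_k_positive 2 phi -> positive_op a ->
  0 <= '[phi a z, z] - s * '[phi (mul a b) w, z]
       - s^* * '[phi (mul (adjoint b) a) z, w]
       + s * s^* * '[phi (mul (adjoint b) (mul a b)) w, w].
Proof.
move=> phi2 a0.
pose v (i : 'I_2) := if i == 0 then bop_id K else b.
pose x (i : 'I_2) := if i == 0 then z else (- s) *: w.
have psd := twisted_positive_row v x phi2 a0.
rewrite !big_ord_recl !big_ord0 /= !addr0 /x /v /= in psd.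
rewrite adjoint_id !twist1l !twist1r in psd.
rewrite !linearZ_LR /= !linearZl_LR /= in psd.
apply: le_trans psd _; rewrite le_eqVlt; apply/orP; left; apply/eqP.
rewrite rmorphN /=; ring.
Qed.

End TwistedPositivity.

(** * The completely positive minorant *)

Section Minorant.
Variables (R : realType) (K H : hilbertType R) (c : bool).
Variables (phi : bop 'B(K) 'B(H)) (y : H).
Local Notation C := R[i].
Local Notation mul := (@twist R K c).
Hypothesis phi_pos : positive_map phi.
Hypothesis phi2 : twisted_k_positive c 2 phi.
Implicit Types (a b : 'B(K)) (z w : H) (d : C).

(** The GNS form of the state [a |-> '[phi a y, y]]. *)
Definition state_form b b' := '[phi (mul (adjoint b') b) y, y].

Fact state_form_bilinear : bilinear_for *%R (Num.conj \; *%R) state_form.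
Proof.
split=> [b'|b] k b1 b2; rewrite /state_form /=.
  by rewrite linearPr linearP /= linearPl.
by rewrite adjoint_conj_linear linearPl linearP /= linearPl.
Qed.

HB.instance Definition _ := bilinear_isBilinear.Build C 'B(K) 'B(K) C
  *%R (Num.conj \; *%R) state_form state_form_bilinear.

Lemma twisted_square_pos a b : positive_op a ->
  positive_op (mul (adjoint b) (mul a b)).
Proof.
move=> a0.
have := @twisted_sum_pos R K c 1 _ (fun=> b) (psd_const a0).
by rewrite !big_ord1 !mxE; case: c.
Qed.

Lemma state_form_ge0 b : 0 <= state_form b b.
Proof.
rewrite /state_form -[X in mul _ X](twist1l c).
by apply/phi_pos/twisted_square_pos/pos_id.
Qed.

Lemma schwarz a b z : positive_op a ->
  '[phi (mul (adjoint b) a) z, y] = '[phi (mul a b) y, z]^* /\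
  `|'[phi (mul a b) y, z]| ^+ 2 <= '[phi a z, z] * state_form (mul a b) b.
Proof.
move=> a0; apply: psd2P; first by apply/phi_pos/twisted_square_pos.
by move=> s; exact: two_positive_psd.
Qed.

Let M := sqrtC `|phi (bop_id K)|.

Let M_ge0 : 0 <= M. Proof. by rewrite sqrtC_ge0. Qed.

(** The Schwarz inequality for [a = 1] and [z = phi b y]: this makes
    [b |-> phi b y] an operator from the GNS space to [H]. *)
Lemma apply_le b : `|phi b y| <= M * seminorm state_form b.
Proof.
set z := phi b y; have [->|z_neq0] := eqVneq z 0.
  by rewrite normr0 mulr_ge0 ?seminorm_ge0 //; exact: state_form_ge0.
have z_gt0 : 0 < `|z| ^+ 2 by rewrite exprn_gt0 ?normr_gt0.
rewrite -(@ler_pXn2r _ 2) ?nnegrE // ?mulr_ge0 ?seminorm_ge0 //; last first.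
  exact: state_form_ge0.
rewrite exprMn sqr_seminorm sqrtCK -(ler_pM2r z_gt0).
have [_] := schwarz b z (@pos_id R K); rewrite twist1l -/z.
rewrite -normr_inner normrX normr_id.
rewrite expr2 => /le_trans; apply; rewrite mulrAC ler_wpM2r ?state_form_ge0 //.
have phi1_pos := phi_pos (@pos_id R K).
rewrite (le_trans (real_ler_norm _)) ?ger0_real ?phi1_pos //.
by rewrite (le_trans (inner_le _ _)) // expr2 mulrA ler_wpM2r // bop_le.
Qed.

(** Boundedness of the GNS representation. *)
Lemma seminorm_mul a b :
  seminorm state_form (mul a b) <= `|a| * seminorm state_form b.
Proof.
have n_ge0 := seminorm_ge0 state_form_ge0.
rewrite -(@ler_pXn2r _ 2) ?nnegrE ?mulr_ge0 //.
rewrite exprMn !sqr_seminorm.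
have := phi_pos (twisted_square_pos b (norm_bound_pos c a)) y.
rewrite /= /state_form adjoint_twist -!twistA linearBl linearBr /=.
rewrite linearZl_LR linearZr_LR /= twist1l -!twistA.
rewrite linearB linearBl /= linearZ linearZl_LR /=.
by rewrite subr_ge0.
Qed.

Definition vector_functional z b := '[phi b y, z].

Fact vector_functional_linear z : scalar (vector_functional z).
Proof. by move=> k b b'; rewrite /vector_functional linearP /= linearPl. Qed.

Lemma vector_functional_le z b :
  `|vector_functional z b| <= M * `|z| * seminorm state_form b.
Proof.
by rewrite (le_trans (inner_le _ _)) // mulrAC ler_wpM2r // apply_le.
Qed.

(** [approx z d b]: the class of [b] in the GNS space of the state
    [a |-> '[phi a y, y]] is within [d] of the image of [z] under the adjoint of
    [b |-> phi b y]. *)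
Definition approx z d b := represents state_form (vector_functional z) d b.

Lemma ex_approx z d : 0 < d -> exists b, approx z d b.
Proof.
apply: (ex_represents state_form_ge0 (@vector_functional_linear z)
  _ (vector_functional_le z)).
by rewrite mulr_ge0.
Qed.

Lemma approx_dist z d d' b b' : 0 <= d -> 0 <= d' ->
  approx z d b -> approx z d' b' -> seminorm state_form (b - b') <= d + d'.
Proof. by move=> d0 d'0; apply: (represents_dist state_form_ge0). Qed.

Lemma approx_linear z z' k d b b' : approx z d b -> approx z' d b' ->
  approx (k *: z + z') ((`|k| + 1) * d) (k *: b + b').
Proof.
move=> zb zb' x; rewrite linearPr /vector_functional linearPr /=.
rewrite [_ - _](_ : _ = k^* * (vector_functional z x - state_form x b) +
  (vector_functional z' x - state_form x b')); last first.
  by rewrite /vector_functional /=; ring.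
rewrite (le_trans (ler_normD _ _)) // mulrDl mul1r mulrDl lerD //.
by rewrite normrM norm_conjC -mulrA ler_wpM2l.
Qed.

Lemma approx_seminorm z d b : 0 <= d -> approx z d b ->
  seminorm state_form b <= M * `|z| + d.
Proof.
move=> d0 zb; rewrite -[b]subr0 [leRHS]addrC.
apply: (approx_dist (z := z) d0 _ zb); first by rewrite mulr_ge0.
by move=> x; rewrite linear0r subr0; exact: vector_functional_le.
Qed.

(** As [d] tends to 0, the class of [b] tends to the vector [v] of the GNS space
    that corresponds to [z], and [phi (mul a b) y] to the image in [H] of [a]
    acting on [v]. *)
Lemma ex_minorant a z : exists h, forall d b, 0 < d -> approx z d b ->
  `|phi (mul a b) y - h| <= M * `|a| * d.
Proof.
have [||||h hP] := @ex_small_limit R H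
  (fun d => [set phi (mul a b) y | b in approx z d])%classic (M * `|a|).
- by rewrite mulr_ge0.
- by move=> d d0; have [b zb] := ex_approx z d0; exists (phi (mul a b) y), b.
- move=> d d' d0 dd' _ [b zb <-]; exists b => // x.
  rewrite (le_trans (zb x)) // ler_wpM2r // seminorm_ge0 //.
  exact: state_form_ge0.
- move=> d d' _ _ d0 d'0 [b zb <-] [b' zb' <-].
  have -> : phi (mul a b) y - phi (mul a b') y = phi (mul a (b - b')) y.
    by rewrite linearBr /= linearB.
  rewrite (le_trans (apply_le _)) // -mulrA ler_wpM2l //.
  rewrite (le_trans (seminorm_mul _ _)) // ler_wpM2l //.
  by apply: approx_dist zb zb'; exact: ltW.
by exists h => d b d0 zb; apply: hP => //; exists b.
Qed.

Definition minorant_fun a z := projT1 (cid (ex_minorant a z)).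

Lemma minorant_approx a z d b : 0 < d -> approx z d b ->
  `|phi (mul a b) y - minorant_fun a z| <= M * `|a| * d.
Proof. exact: (projT2 (cid (ex_minorant a z))). Qed.

Fact minorant_fun_linear a : linear (minorant_fun a).
Proof.
move=> k z z'; apply/subr0_eq.
apply: (@eq0_of_small _ _ _ (2 * ((`|k| + 1) * (M * `|a|)))).
  by rewrite !mulr_ge0 ?addr_ge0.
move=> d d0; have [b zb] := ex_approx z d0; have [b' zb'] := ex_approx z' d0.
have kd0 : 0 < (`|k| + 1) * d by rewrite mulr_gt0 // ltr_wpDl.
have lim_kz := minorant_approx a kd0 (approx_linear k zb zb').
rewrite [leLHS]distrC [X in `|X|](_ : _ =
  (phi (mul a (k *: b + b')) y - minorant_fun a (k *: z + z'))
  - (k *: (phi (mul a b) y - minorant_fun a z)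
     + (phi (mul a b') y - minorant_fun a z'))); last first.
  rewrite linearPr linearP /= scalerBr addrACA -opprD.
  by rewrite [RHS]addrC opprB addrA subrK addrC.
rewrite (le_trans (ler_normB _ _)) //.
have -> : 2 * ((`|k| + 1) * (M * `|a|)) * d =
  M * `|a| * ((`|k| + 1) * d) + (`|k| * (M * `|a| * d) + M * `|a| * d) by ring.
rewrite lerD // (le_trans (ler_normD _ _)) // lerD ?minorant_approx //.
by rewrite normrZ ler_wpM2l // minorant_approx.
Qed.

Lemma minorant_fun_le a z : `|minorant_fun a z| <= M ^+ 2 * `|a| * `|z|.
Proof.
apply: (@le_of_small _ _ _ (2 * (M * `|a|))); first by rewrite !mulr_ge0.
move=> d d0; have [b zb] := ex_approx z d0.
rewrite -[minorant_fun a z](subKr (phi (mul a b) y)).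
rewrite (le_trans (ler_normB _ _)) //.
have -> : M ^+ 2 * `|a| * `|z| + 2 * (M * `|a|) * d =
  M * (`|a| * (M * `|z| + d)) + M * `|a| * d by ring.
rewrite lerD ?minorant_approx // (le_trans (apply_le _)) // ler_wpM2l //.
by rewrite (le_trans (seminorm_mul _ _)) // ler_wpM2l // approx_seminorm // ltW.
Qed.

Fact minorant_fun_bounded a :
  exists N : C, forall z, `|minorant_fun a z| <= N * `|z|.
Proof. by exists (M ^+ 2 * `|a|) => z; exact: minorant_fun_le. Qed.

Definition minorant_op a : 'B(H) :=
  Bop (@minorant_fun_linear a) (minorant_fun_bounded a).

Fact minorant_op_linear : linear minorant_op.
Proof.
move=> k a a'; apply: bopP => z /=.
pose B := M * (`|k *: a + a'| + (`|k| * `|a| + `|a'|)).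
apply/subr0_eq/(@eq0_of_small _ _ _ B); rewrite /B.
  by rewrite mulr_ge0 // !addr_ge0 // mulr_ge0.
move=> d d0; have [b zb] := ex_approx z d0.
rewrite [leLHS]distrC [X in `|X|](_ : _ =
  (phi (mul (k *: a + a') b) y - minorant_fun (k *: a + a') z)
  - (k *: (phi (mul a b) y - minorant_fun a z)
     + (phi (mul a' b) y - minorant_fun a' z))); last first.
  rewrite linearPl linearP /= scalerBr addrACA -opprD.
  by rewrite [RHS]addrC opprB addrA subrK addrC.
rewrite (le_trans (ler_normB _ _)) // mulrDr mulrDl lerD ?minorant_approx //.
rewrite (le_trans (ler_normD _ _)) // mulrDr mulrDl lerD ?minorant_approx //.
rewrite normrZ [leRHS](_ : _ = `|k| * (M * `|a| * d)); last by ring.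
by rewrite ler_wpM2l // minorant_approx.
Qed.

Fact minorant_op_bounded : exists N : C, forall a, `|minorant_op a| <= N * `|a|.
Proof.
exists (M ^+ 2) => a; apply: opnorm_le => [|z]; last exact: minorant_fun_le.
by rewrite mulr_ge0 ?exprn_ge0.
Qed.

Definition minorant : bop 'B(K) 'B(H) :=
  Bop minorant_op_linear minorant_op_bounded.

(** The pairing is that of [a] between the vectors of the GNS space that
    correspond to [z] and [w]: this is the complete positivity of [minorant],
    before the passage to the limit. *)
Lemma minorant_pairing a z w d b b' : 0 < d -> d <= 1 ->
  approx z d b -> approx w d b' ->
  `|'[minorant a z, w] - state_form (mul a b) b'| <=
    `|a| * (M * `|w| + M * `|z| + 1) * d.
Proof.
move=> d0 d1 zb wb'.
rewrite [_ - _](_ : _ =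
  (vector_functional w (mul a b) - state_form (mul a b) b')
  - '[phi (mul a b) y - minorant a z, w]); last first.
  by rewrite /vector_functional linearBl /=; ring.
rewrite (le_trans (ler_normB _ _)) //.
have -> : `|a| * (M * `|w| + M * `|z| + 1) * d =
  d * (`|a| * (M * `|z| + 1)) + M * `|a| * d * `|w| by ring.
apply: lerD; last first.
  by rewrite (le_trans (inner_le _ _)) // ler_wpM2r // minorant_approx.
rewrite (le_trans (wb' _)) // ler_pM2l // (le_trans (seminorm_mul _ _)) //.
rewrite ler_wpM2l // (le_trans (approx_seminorm (ltW d0) zb)) //.
by rewrite lerD2l.
Qed.

Lemma minorant_twisted_positive k : twisted_k_positive c k minorant.
Proof.
apply/twisted_k_positiveP => A A0 x.
pose A' i j := if c then A j i else A i j.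
pose err i j := `|A' i j| * (M * `|x i| + M * `|x j| + 1).
apply: (@ge0_of_small _ _ (\sum_i \sum_j err i j)).
  do 2![apply: sumr_ge0 => ? _]; rewrite mulr_ge0 // !addr_ge0 // mulr_ge0 //.
move=> d d0 d1.
have [b bP] := choice (fun i => ex_approx (x i) d0).
exists (\sum_i \sum_j state_form (mul (A' i j) (b j)) (b i)).
  have := phi_pos (twisted_sum_pos c b A0) y; congr (0 <= _).
  rewrite linear_sum bop_sumE linear_sumlz; apply: eq_bigr => i _.
  by rewrite linear_sum bop_sumE linear_sumlz; apply: eq_bigr => j _.
rewrite -sumrB mulr_suml (le_trans (ler_norm_sum _ _ _)) //.
apply: ler_sum => i _; rewrite -sumrB mulr_suml.
rewrite (le_trans (ler_norm_sum _ _ _)) //.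
by apply: ler_sum => j _; exact: minorant_pairing.
Qed.

Lemma minorant_positive : positive_map minorant.
Proof. exact/twisted_1_positive/minorant_twisted_positive. Qed.

(** The Schwarz inequality [0 <= '[phi a z, z] - t - t^* + g], where
    [t = '[phi (mul a b) y, z]] and [g = state_form (mul a b) b] both tend to
    ['[minorant a z, z]] as [b] approximates [z]. *)
Lemma minorant_le : positive_map (phi - minorant).
Proof.
move=> a a0 z; set s := '[minorant a z, z].
have sJ : s^* = s by apply/CrealP/ger0_real/minorant_positive.
pose err := M * `|a| * `|z|; pose err' := `|a| * (M * `|z| + M * `|z| + 1).
apply: (@ge0_of_small _ _ (err + err + err')).
  by rewrite !addr_ge0 // mulr_ge0 // ?addr_ge0 // mulr_ge0.
move=> d d0 d1; have [b zb] := ex_approx z d0.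
set t := '[phi (mul a b) y, z].
exists ('[phi a z, z] - t - t^* + state_form (mul a b) b).
  have := two_positive_psd b z y 1 phi2 a0.
  by have [-> _] := schwarz b z a0; rewrite rmorph1 !mul1r.
have st : `|t - s| <= err * d.
  rewrite /t /s -linearBl (le_trans (inner_le _ _)) // /err mulrAC ler_wpM2r //.
  exact: minorant_approx.
have -> : '[(phi - minorant) a z, z]
    - ('[phi a z, z] - t - t^* + state_form (mul a b) b) =
    (t - s) + (t - s)^* + (s - state_form (mul a b) b).
  by rewrite linearBl rmorphB /= sJ /s /=; ring.
rewrite !mulrDl (le_trans (ler_normD _ _)) // lerD ?minorant_pairing //.
by rewrite (le_trans (ler_normD _ _)) // norm_conjC lerD.
Qed.

(** The class of the identity is exactly the vector that corresponds to [y]. *)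
Lemma minorant_cyclic : minorant (bop_id K) y = phi (bop_id K) y.
Proof.
symmetry; apply/subr0_eq/(@eq0_of_small _ _ _ (M * `|bop_id K|)).
  by rewrite mulr_ge0.
move=> d d0; rewrite -{1}[bop_id K](twist1l c) minorant_approx // => x.
rewrite /vector_functional /= /state_form adjoint_id twist1l subrr normr0.
by rewrite mulr_ge0 ?seminorm_ge0 ?(ltW d0) //; exact: state_form_ge0.
Qed.

(** The norm of [b |-> phi b y] is controlled by that of [phi 1]. *)
Lemma apply_eq0 : phi (bop_id K) = 0 -> forall b, phi b y = 0.
Proof.
move=> phi10 b; apply/eqP; rewrite -normr_le0 (le_trans (apply_le b)) //.
by rewrite /M phi10 normr0 sqrtC0 mul0r.
Qed.

End Minorant.

(** Extremality makes [minorant] a multiple of [phi], and the choice of [y]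
    makes the factor nonzero. *)
Lemma extremal_twisted_positive (R : realType) (K H : hilbertType R) (c : bool)
    (phi : bop 'B(K) 'B(H)) :
  phi <> 0 -> extremal (@positive_map R K H) phi ->
  twisted_k_positive c 2 phi -> forall k, twisted_k_positive c k phi.
Proof.
move=> phi0 [phi_pos [_ _ phi_face]] phi2 k.
have [y phi1y] : exists y, phi (bop_id K) y != 0.
  apply: contrapT => /forallNP phi1.
  apply: phi0; apply: bopP => b; apply: bopP => y.
  apply: (apply_eq0 y phi_pos phi2); apply: bopP => z.
  by apply/eqP/negPn/negP; exact: phi1.
pose psi := minorant y phi_pos phi2.
have [s /= s0 psiE] : ray phi psi.
  apply: (phi_face psi phi); first exact: minorant_positive.
    exact: minorant_le.
  by exists 1; rewrite /= ?scale1r.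
have s_neq0 : s != 0.
  apply: contraNneq phi1y => s_eq0.
  by rewrite -(minorant_cyclic y phi_pos phi2) -/psi -psiE s_eq0 scale0r.
rewrite -[phi](scalerK s_neq0) psiE.
apply: twisted_k_positiveZ; first by rewrite invr_ge0.
exact: minorant_twisted_positive.
Qed.

Theorem theorem3p3 (R : realType) (K H : hilbertType R)
    (phi : bop 'B(K) 'B(H)) :
  phi <> 0 -> extremal (@positive_map R K H) phi ->
  (k_positive 2 phi -> completely_positive phi) /\
  (k_copositive 2 phi -> completely_copositive phi).
Proof.
move=> phi0 phi_ext; split.
  exact: (@extremal_twisted_positive R K H false).
exact: (@extremal_twisted_positive R K H true).
Qed.
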